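(* Let $p>10$ be a prime. For real $a<b$ write $\big(\frac{\prod}{p}\big)(a,b)=\prod_{x\in\mathbb Z,\ a<x<b}\big(\frac{x}{p}\big)$, and let $\#N_p(3)$ be the number of quadratic non-residues modulo $p$ among the integers in $(p/6,p/3)$. Then $$(-1)^{\#N_p(3)}=\Big(\frac{\prod}{p}\Big)(p/6,p/3)=\begin{cases}\big(\frac{2}{p}\big)\big(\frac{\prod}{p}\big)(0,p/3) & p\equiv1\pmod{12},\\ \big(\frac{\prod}{p}\big)(0,p/3) & p\equiv5\pmod{12},\\ -\big(\frac{\prod}{p}\big)(p/3,p/2) & p\equiv7\pmod{12},\\ \big(\frac{2}{p}\big)\big(\frac{\prod}{p}\big)(p/3,p/2) & p\equiv11\pmod{12}.\end{cases}$$
   Context: $\big(\frac{\cdot}{p}\big)$ is the Legendre symbol. *)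

(* Defs.v *)
From HB Require Import structures.
From mathcomp Require Export all_boot all_order all_algebra.
From mathcomp Require Export finmap.
From mathcomp Require Export all_classical all_reals.

Set Implicit Arguments.
Unset Strict Implicit.
Unset Printing Implicit Defensive.

Import Order.TTheory GRing.Theory Num.Theory.

Local Open Scope classical_set_scope.
Local Open Scope ring_scope.

Definition is_square_mod (p : nat) (x : int) : Prop :=
  exists y : int, (y ^+ 2 = x %[mod p])%Z.

Definition quadratic_nonresidue (p : nat) (x : int) : Prop :=
  ~~ (p %| x)%Z /\ ~ is_square_mod p x.

Definition legendre (p : nat) (x : int) : int :=
  if (p %| x)%Z then 0 else if `[< is_square_mod p x >] then 1 else -1.

Definition int_oo (R : realType) (a b : R) : set int :=
  [set x : int | a < x%:~R < b].

(* [fset_set A] and the finitely supported product over [A] are the intended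
   notions only for finite [A]; [int_oo a b] always is. *)
Lemma finite_int_oo (R : realType) (a b : R) : finite_set (int_oo a b).
Proof.
set m := Num.floor a; set n := `|Num.ceil b - m|%N.
apply: (@sub_finite_set _ _ ((fun i : nat => m + i%:Z) @` `I_n)); last first.
  exact/finite_image/finite_II.
move=> x /= /andP[ax xb].
have mx : m <= x by rewrite -(intrKfloor (R := R) x) /m le_floor // ltW.
have xn : x < Num.ceil b by rewrite ceil_gt_int.
exists `|x - m|%N.
  rewrite /n -ltz_nat !gez0_abs ?subr_ge0 //; first by rewrite ltrD2r.
  by apply: le_trans mx _; apply: ltW.
by rewrite /= gez0_abs ?subr_ge0 // subrKC.
Qed.

Definition legendre_prod (R : realType) (p : nat) (a b : R) : int :=
  \big[*%R/1]_(x \in int_oo a b) legendre p x.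

Definition num_nonresidues (R : realType) (p : nat) (a b : R) : nat :=
  #|` fset_set (int_oo a b `&` quadratic_nonresidue p) |%fset.

(* Main.v *)
(** The map sending [x] to [2x] if [x < p/4] and to [p - 2x] otherwise permutes
    the integers of (0, p/2) and carries (p/6, p/3) bijectively onto (p/3, p/2).
    Taking Legendre symbols, the first bijection computes (2/p) when
    p = 3 mod 4, and the second relates the products over (p/6, p/3) and
    (p/3, p/2) up to powers of (2/p) and (-1/p).  When p = 1 mod 4, the
    symbol of ((p-1)/2)! is (2/p), so the product over (0, p/2) is known, and the
    product over (0, p/6) follows. *)
Require Import Defs.
From mathcomp Require Import fingroup cyclic finfield zify ring.

Set Implicit Arguments.
Unset Strict Implicit.
Unset Printing Implicit Defensive.

Import Order.TTheory GRing.Theory Num.Theory.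
Local Open Scope ring_scope.

(** * Products of nonsquares in a finite field, and elementary arithmetic *)

Lemma mul_nonsquares (F : finFieldType) (x y : F) :
  ~ (exists a, a ^+ 2 = x) -> ~ (exists a, a ^+ 2 = y) ->
  exists a, a ^+ 2 = x * y.
Proof.
have /cyclicP[g gP] : cyclic [set: {unit F}] by exact: field_unit_group_cyclic.
(* An even power of the generator has the root given by half the exponent, so nonsquares are odd
   powers, and two odd exponents add up to an even one. *)
have genP z : ~ (exists a, a ^+ 2 = z) -> exists2 i, odd i & z = val g ^+ i.
  move=> nsq_z; have z0 : z != 0.
    by apply/eqP => z0; apply: nsq_z; exists 0; rewrite expr0n z0.
  have zU : z \is a GRing.unit by rewrite unitfE.
  have : Sub z zU \in <[g]>%g by rewrite -gP inE.
  case/cycleP => i /(congr1 val) /=; rewrite FinRing.val_unitX => zE.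
  exists i => //; apply: contraT => /even_halfK iE; case: nsq_z.
  by exists (val g ^+ i./2); rewrite -exprM muln2 iE zE.
move=> /genP[i odd_i ->] /genP[j odd_j ->]; exists (val g ^+ (i + j)./2).
by rewrite -exprM -exprD muln2 even_halfK // oddD odd_i odd_j.
Qed.

Lemma divn_12Dl (k r : nat) :
  [/\ (12 * k + r)./2 = 6 * k + r./2, (12 * k + r) %/ 4 = 3 * k + r %/ 4,
      (12 * k + r) %/ 3 = 4 * k + r %/ 3 & (12 * k + r) %/ 6 = 2 * k + r %/ 6]%N.
Proof. by split; lia. Qed.

Lemma sqr1_expr (R : pzRingType) (x : R) (n : nat) :
  x ^+ 2 = 1 -> x ^+ n = x ^+ odd n.
Proof.
move=> x2; rewrite -{1}(odd_double_half n) -mul2n exprD exprM x2 expr1n.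
by rewrite mulr1.
Qed.

(** * The Legendre symbol read in ['F_p], and its multiplicativity *)

Section LegendreSymbol.
Variables (p : nat) (p_prime : prime p).

Let dvdpE (x : int) : (p %| x)%Z = (x%:~R == 0 :> 'F_p).
Proof. exact/dvdz_pcharf/pchar_Fp. Qed.

Lemma is_square_modP (x : int) :
  is_square_mod p x <-> exists a : 'F_p, a ^+ 2 = x%:~R.
Proof.
have eqE (y : int) : (y ^+ 2 = x %[mod p])%Z <-> y%:~R ^+ 2 = x%:~R :> 'F_p.
  rewrite (rwP eqP) eqz_mod_dvd dvdpE rmorphB rmorphXn subr_eq0.
  by split=> /eqP.
split=> [[y /eqE yx]|[a ax]]; first by exists y%:~R.
by exists (a : nat)%:Z; apply/eqE; rewrite -pmulrn natr_Zp.
Qed.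

Lemma legendre_eq0 (x : int) : (legendre p x == 0) = (p %| x)%Z.
Proof. by rewrite /legendre; case: ifP => // _; case: ifP. Qed.

Lemma legendre_sqr (x : int) : ~~ (p %| x)%Z -> legendre p x ^+ 2 = 1.
Proof. by rewrite /legendre => /negbTE ->; case: ifP. Qed.

Lemma legendre_square (x y : int) :
  ~~ (p %| x)%Z -> y%:~R ^+ 2 = x%:~R :> 'F_p -> legendre p x = 1.
Proof.
rewrite /legendre => /negbTE -> yx; case: asboolP => // -[].
by apply/is_square_modP; exists y%:~R.
Qed.

Lemma legendre_eq (x y : int) :
  x%:~R = y%:~R :> 'F_p -> legendre p x = legendre p y.
Proof.
move=> xy; have sqE : is_square_mod p x <-> is_square_mod p y.
  by rewrite !is_square_modP xy.
by rewrite /legendre !dvdpE xy (asbool_equiv_eq sqE).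
Qed.

Lemma legendreM (x y : int) : legendre p (x * y) = legendre p x * legendre p y.
Proof.
rewrite /legendre !dvdpE rmorphM mulf_eq0.
have [x0|x0] := eqVneq (x%:~R : 'F_p) 0; first by rewrite mul0r.
have [y0|y0] := eqVneq (y%:~R : 'F_p) 0; first by rewrite mulr0.
(* Dividing roots excludes a square product with exactly one square factor; the case of two
   nonsquares is [mul_nonsquares]. *)
have cancel_sq (u v : 'F_p) : u != 0 ->
    (exists a, a ^+ 2 = u) -> (exists a, a ^+ 2 = u * v) ->
    exists a, a ^+ 2 = v.
  move=> u0 [a au] [b buv]; exists (b / a).
  by rewrite expr_div_n au buv mulrAC divff ?mul1r.
rewrite !(asbool_equiv_eq (is_square_modP _)) rmorphM.
case: asboolP => sxy; case: asboolP => sx; case: asboolP => sy //=.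
- by case: sy; apply: cancel_sq sxy.
- by case: sx; rewrite mulrC in sxy; apply: cancel_sq sxy.
- case: sxy => /=; case: sx sy => [a <-] [b <-].
  by exists (a * b); rewrite exprMn.
- by case: sxy; apply: mul_nonsquares.
Qed.

Let natp_eq0 : p%:R = 0 :> 'F_p.
Proof. exact/pcharf0/pchar_Fp. Qed.

Lemma legendre_subl (x : int) :
  legendre p (p%:Z - x) = legendre p (-1) * legendre p x.
Proof.
rewrite -legendreM mulN1r; apply: legendre_eq.
by rewrite rmorphB rmorphN /= -pmulrn natp_eq0 sub0r.
Qed.

(** * Wilson's theorem, the half factorial and the symbol of -1 *)

Lemma wilson_Fp : (p.-1)`!%:R = -1 :> 'F_p.
Proof.
have := p_prime; rewrite (Wilson (prime_gt1 p_prime)).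
rewrite (dvdn_pcharf (pchar_Fp p_prime)) -natr1 addr_eq0.
by move/eqP.
Qed.

(* Pairing [x] with [p - x] in Wilson's theorem. *)
Lemma half_factorial_sqr : (p %% 4 = 1)%N -> (p./2)`!%:R ^+ 2 = -1 :> 'F_p.
Proof.
move=> p1; rewrite -wilson_Fp.
have -> : p.-1 = (p./2 + p./2)%N by lia.
rewrite !fact_prod [in RHS](@big_cat_nat _ _ _ p./2.+1) //=; last by lia.
rewrite natrM expr2; congr (_ * _).
rewrite [in RHS]big_nat_rev /= -[in RHS](add0n p./2.+1) big_addn.
rewrite !natr_prod.
have -> : ((p./2 + p./2).+1 - p./2.+1 = p./2)%N by lia.
rewrite big_add1 /=.
(* The inserted sign is 1 because [p./2] is even; distributed over the factors, it turns each [i.+1]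
   into [p - i.+1]. *)
transitivity ((-1) ^+ p./2 * \prod_(0 <= i < p./2) i.+1%:R : 'F_p).
  by rewrite -signr_odd (_ : odd p./2 = false) ?mul1r //; lia.
rewrite -[X in _ ^+ X]subn0 -prodr_const_nat -big_split /=.
apply: eq_big_nat => i ip; rewrite mulN1r.
rewrite (_ : (_ - _)%N = (p - i.+1)%N); last by lia.
by rewrite natrB ?natp_eq0 ?sub0r //; lia.
Qed.

Let F1_neqN1 : (2 < p)%N -> 1 != -1 :> 'F_p.
Proof.
move=> p2; rewrite eq_sym -subr_eq0 -opprD oppr_eq0 -(natrD _ 1 1).
by rewrite -(dvdn_pcharf (pchar_Fp p_prime)) gtnNdvd.
Qed.

Let notdvd (x : nat) : (0 < x < p)%N -> ~~ (p %| x%:Z)%Z.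
Proof. by case/andP=> x0 xp; rewrite dvdzE /= gtnNdvd. Qed.

Let notdvdN1 : ~~ (p %| (-1 : int))%Z.
Proof. by rewrite dvdzE /= gtnNdvd // prime_gt1. Qed.

Lemma legendreN1_1mod4 : (p %% 4 = 1)%N -> legendre p (-1) = 1.
Proof.
move=> p1; apply: (@legendre_square _ (p./2)`!%:Z) => //.
by rewrite -pmulrn half_factorial_sqr // rmorphN.
Qed.

(** By Fermat, a root [a] of -1 would give 1 = a^(p-1) = (-1)^((p-1)/2) = -1, since (p-1)/2 is
    odd. *)
Lemma legendreN1_3mod4 : (p %% 4 = 3)%N -> legendre p (-1) = -1.
Proof.
move=> p3; rewrite /legendre (negbTE notdvdN1); case: asboolP => //.
move=> /is_square_modP[a]; rewrite rmorphN /= => aN1.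
have /eqP[] : 1 != -1 :> 'F_p by apply: F1_neqN1; lia.
have a0 : a != 0.
  by apply: contra_eq_neq aN1 => ->; rewrite expr0n /= eq_sym oppr_eq0 oner_eq0.
have : a ^+ p.-1 = 1.
  apply: (mulfI a0); rewrite mulr1 -exprS prednK ?prime_gt0 //.
  by rewrite -[X in a ^+ X](card_Fp p_prime) expf_card.
have -> : p.-1 = (2 * p./2)%N by lia.
rewrite exprM aN1 -signr_odd (_ : odd p./2 = true) ?expr1 //; lia.
Qed.

Lemma prod_legendre (r : seq int) :
  \prod_(x <- r) legendre p x = legendre p (\prod_(x <- r) x).
Proof.
apply/esym/(big_morph (legendre p) legendreM).
by apply: (@legendre_square _ 1); rewrite ?expr1n // dvdzE /= gtnNdvd // prime_gt1.
Qed.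

(* With [i = ((p-1)/2)!] a square root of [-1], [2 i = (1 + i)^2]. *)
Lemma legendre2_prod_half : (p %% 4 = 1)%N ->
  legendre p 2 * \prod_(1 <= x < p./2.+1) legendre p x = 1.
Proof.
move=> p1.
have p2 : (2 < p)%N by have := prime_gt1 p_prime; lia.
rewrite -(big_map Posz xpredT (legendre p)) prod_legendre big_map -legendreM.
rewrite -(big_morph Posz PoszM (erefl _)) -fact_prod.
have isq := half_factorial_sqr p1.
apply: (@legendre_square _ (1 + (p./2)`!%:Z)); last first.
  by rewrite rmorphD rmorphM /= -!pmulrn sqrrD isq expr1n mul1r mulr_natl; ring.
have i0 : (p./2)`!%:R != 0 :> 'F_p.
  by apply: contra_eq_neq isq => ->; rewrite expr0n /= eq_sym oppr_eq0 oner_eq0.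
rewrite dvdpE rmorphM mulf_neq0 //= -pmulrn //.
by rewrite -(dvdn_pcharf (pchar_Fp p_prime)) gtnNdvd.
Qed.

(** * The folding map, and the symbol of 2 for p = 3 mod 4 *)

Let fold (x : nat) := (if 4 * x < p then x.*2 else p - x.*2)%N.

(** Each [x] contributes one factor (2/p), and each [x] above p/4 a further (-1/p), coming from p -
    2x. The cut at [(p %/ 4).+1] lies in the range, which makes the second exponent exact. *)
Lemma prod_legendre_fold (m n m' n' : nat) :
    odd p -> (n.*2 <= p.+1)%N -> (n'.*2 <= p.+1)%N ->
    (m <= (p %/ 4).+1 <= n)%N ->
    (forall x, (x.*2 < p)%N -> (m <= x < n)%N = (m' <= fold x < n')%N) ->
  \prod_(m' <= y < n') legendre p y =
  legendre p 2 ^+ (n - m) * legendre p (-1) ^+ (n - (p %/ 4).+1) *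
    \prod_(m <= x < n) legendre p x.
Proof.
move=> odd_p np n'p mcn foldE.
(* As [p] is odd, the parity of a value tells which branch of [fold] produced it; this gives both
   injectivity and the preimage. *)
have fold_iota : perm_eq [seq fold x | x <- index_iota m n] (index_iota m' n').
  apply: uniq_perm; rewrite ?iota_uniq ?map_inj_in_uniq ?iota_uniq //.
    by move=> x y; rewrite !mem_index_iota /fold; do 2!case: ifP => ?; lia.
  move=> y; rewrite mem_index_iota; apply/mapP/idP => [[x]|yI].
    rewrite mem_index_iota => xI ->; rewrite -foldE //; lia.
  have [x x_lt yE] : exists2 x, (x.*2 < p)%N & y = fold x.
    exists (if odd y then (p - y)./2 else y./2)%N; first by case: ifP; lia.
    by rewrite /fold; case: (boolP (odd y)) => ?; case: ifP => ?; lia.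
  by exists x => //; rewrite mem_index_iota foldE // -yE.
rewrite -(perm_big _ fold_iota) big_map.
have legfold x : (x.*2 < p)%N ->
    legendre p (fold x) =
    legendre p 2 * (if (4 * x < p)%N then 1 else legendre p (-1)) *
    legendre p x.
  rewrite /fold => xp; case: ifP => _.
    by rewrite mulr1 -muln2 mulnC PoszM legendreM.
  rewrite -subzn; last by lia.
  by rewrite legendre_subl -muln2 mulnC PoszM legendreM mulrCA mulrA.
under eq_big_nat => x xI do (rewrite legfold; last by lia).
rewrite !big_split /= prodr_const_nat; congr (_ * _ * _).
rewrite (@big_cat_nat _ _ _ (p %/ 4).+1) /=; [|lia|lia].
rewrite big_nat_cond big1 ?mul1r; last first.
  by move=> x /andP[xI _]; case: ifP => //; lia.
rewrite -prodr_const_nat; apply: eq_big_nat => x xI; case: ifP => //; lia.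
Qed.

(** Folding the whole of (0, p/2) gives the same nonzero product on both sides, which cancels. The
    sign stays a power, since its parity depends on p mod 8; it is later merged with another power
    of -1. *)
Lemma legendre2_3mod4 : (p %% 4 = 3)%N ->
  legendre p 2 = (-1) ^+ (p./2.+1 - (p %/ 4).+1).
Proof.
move=> p3.
have L2 : legendre p 2 ^+ 2 = 1 by rewrite legendre_sqr // notdvd //; lia.
set Q := \prod_(1 <= x < p./2.+1) legendre p x.
have Q0 : Q != 0.
  rewrite prodf_seq_neq0; apply/allP => x; rewrite mem_index_iota /= => xI.
  by rewrite legendre_eq0 notdvd //; lia.
have : 1 * Q = legendre p 2 ^+ (p./2.+1 - 1) *
    legendre p (-1) ^+ (p./2.+1 - (p %/ 4).+1) * Q.
  rewrite mul1r; apply: prod_legendre_fold; try lia.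
  by move=> x xp; rewrite /fold; case: ifP; lia.
move/(mulIf Q0); rewrite legendreN1_3mod4 // (sqr1_expr _ L2).
(* The exponent (p-1)/2 is odd, so exactly one factor (2/p) survives. *)
rewrite (_ : odd (_ - 1)); last by lia.
by move=> E; rewrite -[RHS]mul1r [X in X * _]E -mulrA -expr2 sqrr_sign mulr1.
Qed.

Lemma prod_legendre_sqr (m n : nat) : (0 < m)%N -> (n <= p)%N ->
  (\prod_(m <= x < n) legendre p x) ^+ 2 = 1.
Proof.
move=> m0 np; rewrite -prodrXl big_nat_cond big1 // => x /andP[xI _].
by rewrite legendre_sqr // notdvd //; lia.
Qed.

End LegendreSymbol.

(** * From real intervals to ranges of natural numbers, and counting nonresidues *)

Section RealIntervals.
Variables (R : realType) (p : nat).

Lemma legendre_prod_nat (a b : R) (m n : nat) :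
    0 <= a -> (forall x : nat, (a < x%:R < b) = (m <= x < n)%N) ->
  legendre_prod p a b = \prod_(m <= x < n) legendre p x.
Proof.
move=> a0 abE; rewrite /legendre_prod -(big_map Posz xpredT (legendre p)).
rewrite [RHS]fsbig_seq; last by rewrite map_inj_uniq ?iota_uniq // => x y [].
congr (\big[_/_]_(x \in _) _); apply/seteqP; split=> [[x|x]|_ /mapP[x xI ->]] /=.
- by rewrite /int_oo /= -pmulrn abE => xI; apply: map_f; rewrite mem_index_iota.
(* Negative integers are excluded by [0 <= a]. *)
- rewrite /int_oo /= NegzE => /andP[ax _].
  have : a < 0 by apply: lt_trans ax _; rewrite ltrz0.
  by rewrite ltNge a0.
- by rewrite /int_oo /= -pmulrn abE -mem_index_iota.
Qed.

Lemma ltr_nat_div (d x : nat) : (0 < d)%N ->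
  (p%:R / d%:R < x%:R :> R) = (p %/ d < x)%N.
Proof. by move=> d0; rewrite ltr_pdivrMr ?ltr0n // -natrM ltr_nat ltn_divLR. Qed.

(** Non-divisibility rules out x e = p, so the strict real bound matches the weak bound by the
    floor. *)
Lemma ltr_div_nat (e x : nat) : (0 < e)%N -> ~~ (e %| p)%N ->
  (x%:R < p%:R / e%:R :> R) = (x <= p %/ e)%N.
Proof.
move=> e0 ep; rewrite ltr_pdivlMr ?ltr0n // -natrM ltr_nat leq_divRL //.
rewrite ltn_neqAle; case: eqP => //= xe.
by rewrite -xe dvdn_mull in ep.
Qed.

Lemma legendre_prod_div (d e : nat) :
    (0 < d)%N -> (0 < e)%N -> ~~ (e %| p)%N ->
  legendre_prod p (p%:R / d%:R : R) (p%:R / e%:R)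
  = \prod_((p %/ d).+1 <= x < (p %/ e).+1) legendre p x.
Proof.
move=> d0 e0 ep; apply: legendre_prod_nat => [|x]; first by rewrite divr_ge0.
by rewrite ltr_nat_div // ltr_div_nat.
Qed.

Lemma legendre_prod_0div (e : nat) : (0 < e)%N -> ~~ (e %| p)%N ->
  legendre_prod p (0 : R) (p%:R / e%:R)
  = \prod_(1 <= x < (p %/ e).+1) legendre p x.
Proof.
move=> e0 ep; apply: legendre_prod_nat => [//|x].
by rewrite ltr0n ltr_div_nat.
Qed.

(** Without multiples of [p], the nonresidues contribute -1 each and all other factors are 1. *)
Lemma expr_num_nonresidues (a b : R) :
    (forall x, int_oo a b x -> ~~ (p %| x)%Z) ->
  (-1) ^+ num_nonresidues p a b = legendre_prod p a b.
Proof.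
move=> ndvd; have fin := finite_int_oo a b.
rewrite /legendre_prod fsbig_finite // /num_nonresidues.
rewrite (bigID (fun x => `[< quadratic_nonresidue p x >])) /=.
rewrite [X in _ * X]big_seq_cond [X in _ * X]big1 ?mulr1; last first.
  move=> x /andP[]; rewrite in_fset_set // => /set_mem/ndvd px /asboolPn nres.
  rewrite /legendre (negbTE px); case: asboolP => // nsq.
  by case: nres.
rewrite -big_filter (eq_big_seq (fun=> -1)); last first.
  move=> x; rewrite mem_filter => /andP[/asboolP[px nsq] _].
  by rewrite /legendre (negbTE px); case: asboolP.
rewrite big_const_seq count_predT iter_mulr_1; congr (_ ^+ _).
apply: perm_size; apply: uniq_perm => [||x].
- exact: fset_uniq.
- exact/filter_uniq/fset_uniq.
rewrite in_fset_set; last exact: finite_setIl.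
by rewrite mem_filter in_fset_set // in_setI andbC; congr (_ && _).
Qed.

End RealIntervals.

(** * The four residue classes modulo 12 *)

Theorem theorem4p10 (R : realType) (p : nat) (p_prime : prime p)
    (p_gt10 : (10 < p)%N) :
  let P : R := p%:R in
  (-1) ^+ num_nonresidues p (P / 6) (P / 3) = legendre_prod p (P / 6) (P / 3)
  /\ ((p = 1 %[mod 12])%N ->
        legendre_prod p (P / 6) (P / 3)
        = legendre p 2 * legendre_prod p 0 (P / 3))
  /\ ((p = 5 %[mod 12])%N ->
        legendre_prod p (P / 6) (P / 3) = legendre_prod p 0 (P / 3))
  /\ ((p = 7 %[mod 12])%N ->
        legendre_prod p (P / 6) (P / 3) = - legendre_prod p (P / 3) (P / 2))
  /\ ((p = 11 %[mod 12])%N ->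
        legendre_prod p (P / 6) (P / 3)
        = legendre p 2 * legendre_prod p (P / 3) (P / 2)).
Proof.
move=> P.
have ndvd e : (1 < e < p)%N -> ~~ (e %| p)%N.
  move=> /andP[e1 ep]; apply/negP; case/primeP: p_prime => _ /[apply].
  by rewrite gtn_eqF // ltn_eqF.
split; first apply: expr_num_nonresidues.
  move=> x /andP[x_gt x_lt].
  have x0 : 0 < x.
    by rewrite -(ltr0z R); apply: le_lt_trans x_gt; rewrite divr_ge0.
  have xp : x < p%:Z.
    rewrite -(ltr_int R) -pmulrn; apply: lt_le_trans x_lt _.
    by rewrite ler_piMr ?invf_le1 ?ler1n.
  by rewrite dvdzE /= gtnNdvd //; lia.
rewrite !(legendre_prod_div, legendre_prod_0div) ?ndvd //; try lia.
(* The interval (0, p/2) is cut at p/6 and p/3 into three products. *)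
set A := \prod_(1 <= x < (p %/ 6).+1) legendre p x.
set B := \prod_((p %/ 6).+1 <= x < (p %/ 3).+1) legendre p x.
set C := \prod_((p %/ 3).+1 <= x < (p %/ 2).+1) legendre p x.
have AB : \prod_(1 <= x < (p %/ 3).+1) legendre p x = A * B.
  by rewrite [LHS](@big_cat_nat _ _ _ (p %/ 6).+1) //=; lia.
have ABC : \prod_(1 <= x < p./2.+1) legendre p x = A * B * C.
  by rewrite -divn2 [LHS](@big_cat_nat _ _ _ (p %/ 3).+1) ?AB //=; lia.
have B2 : B ^+ 2 = 1 by apply: prod_legendre_sqr => //; lia.
have L2 : legendre p 2 ^+ 2 = 1.
  by rewrite legendre_sqr // dvdzE /= gtnNdvd //; lia.
have odd_p : odd p by case: (even_prime p_prime) => // p2; lia.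
have p3 : (p %% 3 != 0)%N by rewrite -/(dvdn 3 p) ndvd //; lia.
have CB := prod_legendre_fold p_prime odd_p.
(* Folding carries both (p/6, p/4) and (p/4, p/3) into (p/3, p/2). *)
have {}CB : C = legendre p 2 ^+ ((p %/ 3).+1 - (p %/ 6).+1) *
    legendre p (-1) ^+ ((p %/ 3).+1 - (p %/ 4).+1) * B.
  apply: CB; try lia.
  by move=> x xp /=; case: ifP; lia.
rewrite (sqr1_expr _ L2) in CB.
(* Writing p = 12k + r makes all exponents linear in [k], so that their parities can be decided. *)
have quotE r : p = r %[mod 12] -> (r < 12)%N -> let k := (p %/ 12)%N in
    [/\ p./2 = 6 * k + r./2, p %/ 4 = 3 * k + r %/ 4,
        p %/ 3 = 4 * k + r %/ 3 & p %/ 6 = 2 * k + r %/ 6]%N.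
  move=> pr r12; have pE : (12 * (p %/ 12) + r)%N = p.
    by rewrite [RHS](divn_eq p 12) pr modn_small // mulnC.
  by have := divn_12Dl (p %/ 12) r; rewrite pE.
have mod4E r : p = r %[mod 12] -> (r < 12)%N -> (p %% 4 = r %% 4)%N.
  move=> pr r12.
  by rewrite -(modn_dvdm p (isT : 4 %| 12)%N) pr (modn_small r12).
rewrite AB; clear AB.
split; [|split; [|split]] => pmod; have p4 := mod4E _ pmod isT;
  have {pmod}[q2 q4 q3 q6] := quotE _ pmod isT;
  move: (p %/ 12)%N => k in q2 q4 q3 q6.
(* Here p/3 and p/6 have floors 4k and 2k, so C = B and (2/p) A B^2 = 1. *)
- have := legendre2_prod_half p_prime p4.
  rewrite ABC CB legendreN1_1mod4 // expr1n q3 q6.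
  rewrite (_ : odd _ = false); last by clear; lia.
  move=> E; rewrite -[LHS]mul1r -[X in X * B = _]E.
  transitivity (legendre p 2 * (A * B) * B ^+ 2); first ring.
  by rewrite B2 mulr1.
(* Now the floors differ by 2k + 1, so C = (2/p) B and the two symbols of 2 cancel. *)
- have := legendre2_prod_half p_prime p4.
  rewrite ABC CB legendreN1_1mod4 // expr1n q3 q6.
  rewrite (_ : odd _ = true); last by clear; lia.
  move=> E; rewrite -[LHS]mul1r -[X in X * B = _]E.
  transitivity (legendre p 2 ^+ 2 * (A * B) * B ^+ 2); first ring.
  by rewrite L2 B2 mulr1 mul1r.
(* The powers of -1 from (2/p) and from folding have exponents 3k + 2 and k + 1, with odd sum. *)
- rewrite CB legendreN1_3mod4 // legendre2_3mod4 // q2 q3 q4 q6.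
  rewrite (_ : odd (_ - (2 * k + _).+1) = true); last by clear; lia.
  rewrite expr1 -exprD -signr_odd (_ : odd _ = true); last by clear; lia.
  by rewrite mulN1r opprK.
(* The factor (2/p) drops out of [CB]; the exponents 3k + 3 and k + 1 have even sum. *)
- rewrite CB legendreN1_3mod4 // legendre2_3mod4 // q2 q3 q4 q6.
  rewrite (_ : odd (_ - (2 * k + _).+1) = false); last by clear; lia.
  rewrite mul1r mulrA -exprD -signr_odd (_ : odd _ = false); last by clear; lia.
  by rewrite mul1r.
Qed.
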